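(* Let $m$ agents have nonempty closed convex constraint sets $X_1,\dots,X_m\subseteq\mathbb{R}^n$ such that $X=\bigcap_{i=1}^m X_i$ is nonempty. Suppose the weights $a^i_j(k)$ satisfy the Weights Rule, Doubly Stochasticity, Connectivity and Bounded Intercommunication Interval assumptions (stated in the context). For all $i$, let the sequence $\{x^i(k)\}$ be generated by the projected consensus algorithm $$x^i(k+1)=P_{X_i}\Big[\sum_{j=1}^m a^i_j(k)x^j(k)\Big],\qquad k\ge 0,\quad x^i(0)\in X_i,$$ and let $w^i(k)=\sum_{j=1}^m a^i_j(k)x^j(k)$. Then there is some $\tilde x\in X$ such that $$\lim_{k\to\infty}\|x^i(k)-\tilde x\|=0,\qquad \lim_{k\to\infty}\|w^i(k)-\tilde x\|=0\qquad\text{for all } i\in\{1,\dots,m\}.$$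
   Context: $\|\cdot\|$ is the Euclidean norm and $P_C[z]$ is the Euclidean projection of $z$ on a closed convex set $C$. The weights are real numbers $a^i_j(k)$, $i,j\in\{1,\dots,m\}$, $k\ge0$, with $a^i(k)=(a^i_1(k),\dots,a^i_m(k))'$. Assumptions: Weights Rule: there is a scalar $\eta$ with $0<\eta<1$ such that for all $i$: (a) $a^i_i(k)\ge\eta$ for all $k\ge0$; (b) if $a^i_j(k)>0$ then $a^i_j(k)\ge\eta$. Doubly Stochasticity: (a) $a^i(k)\ge0$ and $\sum_{j=1}^m a^i_j(k)=1$ for all $i,k$; (b) $\sum_{i=1}^m a^i_j(k)=1$ for all $j,k$. Connectivity: let $V=\{1,\dots,m\}$, $E_k=\{(j,i)\mid a^i_j(k)>0\}$, and $E_\infty=\{(j,i)\mid (j,i)\in E_k \text{ for infinitely many } k\}$. The directed graph $(V,E_\infty)$ is strongly connected. Bounded Intercommunication Interval: there is an integer $B\ge1$ such that for every $(j,i)\in E_\infty$ and every $k\ge0$, $(j,i)\in E_k\cup E_{k+1}\cup\dots\cup E_{k+B-1}$. *)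

(* Defs.v *)
From HB Require Import structures.
From mathcomp Require Import all_boot all_order all_algebra.
From mathcomp Require Import all_classical all_reals all_analysis.
Import Order.TTheory GRing.Theory Num.Theory.
Import numFieldNormedType.Exports.

Set Implicit Arguments.
Unset Strict Implicit.
Unset Printing Implicit Defensive.

Local Open Scope classical_set_scope.
Local Open Scope ring_scope.

(* The library norm on 'rV[R]_n is the sup norm, hence this definition; the
   two norms induce the same topology, so [closed] needs no counterpart. *)
Definition enorm (R : realType) (n : nat) (v : 'rV[R]_n) : R :=
  Num.sqrt (\sum_(l < n) v ord0 l ^+ 2).

Definition is_euclid_proj (R : realType) (n : nat) (C : set 'rV[R]_n)
    (z p : 'rV[R]_n) : Prop :=
  C p /\ forall q, C q -> enorm (z - p) <= enorm (z - q).

(* The minimizer exists and is unique when C is nonempty, closed and convex;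
   the default value z is only taken if there is no minimizer. *)
Definition euclid_proj (R : realType) (n : nat) (C : set 'rV[R]_n)
    (z : 'rV[R]_n) : 'rV[R]_n :=
  xget z [set p | is_euclid_proj C z p].

(* In all that follows, a k i j stands for the weight a^i_j(k) that agent i
   gives to agent j at time k. *)
Definition weights_rule (R : realType) (m : nat) (a : nat -> 'M[R]_m) : Prop :=
  exists eta : R, [/\ 0 < eta, eta < 1 & forall i : 'I_m,
    (forall k, eta <= a k i i) /\
    (forall j k, 0 < a k i j -> eta <= a k i j)].

Definition doubly_stochastic (R : realType) (m : nat)
    (a : nat -> 'M[R]_m) : Prop :=
  [/\ forall k i j, 0 <= a k i j,
      forall k i, \sum_(j < m) a k i j = 1 &
      forall k j, \sum_(i < m) a k i j = 1].

(* The edge (j, i) goes from the sender j to the receiver i. *)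
Definition edge (R : realType) (m : nat) (a : nat -> 'M[R]_m) (k : nat) :
    rel 'I_m :=
  [rel j i | 0 < a k i j].

Definition edge_infty (R : realType) (m : nat) (a : nat -> 'M[R]_m) :
    rel 'I_m :=
  [rel j i | `[< infinite_set [set k : nat | edge a k j i] >]].

Definition strongly_connected (V : finType) (e : rel V) : Prop :=
  forall u v : V, connect e u v.

Definition connectivity (R : realType) (m : nat) (a : nat -> 'M[R]_m) : Prop :=
  strongly_connected (edge_infty a).

Definition bounded_intercomm (R : realType) (m : nat)
    (a : nat -> 'M[R]_m) : Prop :=
  exists2 B : nat, (1 <= B)%N &
    forall j i : 'I_m, edge_infty a j i ->
      forall k : nat, exists2 l : nat, (k <= l < k + B)%N & edge a l j i.

(* Main.v *)
(* For q in the intersection of the X_i, S_q k = sum_i |x_i k - q|^2 is a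
   Lyapunov function: the variance identity for the averaging step and the
   Pythagorean inequality for the projection step give
     S_q (k+1) + sum_i (|x_i (k+1) - w_i k|^2
                        + sum_j a_ij k |x_j k - w_i k|^2) <= S_q k.
   So the terms of the sum over i tend to 0. As a_ii >= eta, this yields
   x_i k - w_i k -> 0, hence x_i (k+1) - x_i k -> 0, and also
   a_ij k (x_j k - x_i k) -> 0. Since an edge of E_infty is active, with weight
   at least eta, once in every window of length B, x_j - x_i -> 0 along it, and
   by connectivity for all pairs. No product of the weight matrices is needed.
   By compactness the x_i have a common limit xt along some ultrafilter on nat;
   xt lies in every X_i because these are closed, and S_xt, which converges and
   tends to 0 along the ultrafilter, tends to 0. *)
Require Import Defs.
From HB Require Import structures.
From mathcomp Require Import all_boot all_order all_algebra.
From mathcomp Require Import all_classical all_reals all_analysis.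
From mathcomp Require Import ring lra.
Import Order.TTheory GRing.Theory Num.Theory.
Import numFieldNormedType.Exports.

Set Implicit Arguments.
Unset Strict Implicit.
Unset Printing Implicit Defensive.

Local Open Scope classical_set_scope.
Local Open Scope ring_scope.

Lemma cvg_fin_sum {R : realType} {V : normedModType R} {T : Type}
    (F : set_system T) {FF : Filter F} (I : finType) (f : I -> T -> V) (l : I -> V) :
  (forall i, f i x @[x --> F] --> l i) ->
  \sum_i f i x @[x --> F] --> \sum_i l i.
Proof. by move=> fl; apply: cvg_big => // x; exact: add_continuous. Qed.

(** * Euclidean inner product and norm on row vectors *)

Section euclidean_norm.
Context {R : realType} {n : nat}.
Implicit Types u v z p q : 'rV[R]_n.

Definition dot u v : R := \sum_(l < n) u ord0 l * v ord0 l.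

Lemma dotC u v : dot u v = dot v u.
Proof. by apply: eq_bigr => l _; rewrite mulrC. Qed.

Lemma dotDl u v z : dot (u + v) z = dot u z + dot v z.
Proof. by rewrite /dot -big_split; apply: eq_bigr => l _; rewrite mxE mulrDl. Qed.

Lemma dotZl t u v : dot (t *: u) v = t * dot u v.
Proof. by rewrite /dot mulr_sumr; apply: eq_bigr => l _; rewrite mxE mulrA. Qed.

Lemma dot0l u : dot 0 u = 0.
Proof. by rewrite -(scale0r 0) dotZl mul0r. Qed.

Lemma dotDr u v z : dot u (v + z) = dot u v + dot u z.
Proof. by rewrite dotC dotDl !(dotC u). Qed.

Lemma dotZr t u v : dot u (t *: v) = t * dot u v.
Proof. by rewrite dotC dotZl dotC. Qed.

Lemma dotNl u v : dot (- u) v = - dot u v.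
Proof. by rewrite -scaleN1r dotZl mulN1r. Qed.

Lemma dotNr u v : dot u (- v) = - dot u v.
Proof. by rewrite dotC dotNl dotC. Qed.

Definition dotE := (dotDl, dotDr, dotNl, dotNr, dotZl, dotZr).

Lemma dotBB u v : dot (u - v) (u - v) = dot u u - 2 * dot u v + dot v v.
Proof. by rewrite !dotE (dotC v u); ring. Qed.

Lemma dot_suml (I : finType) (y : I -> 'rV[R]_n) v :
  dot (\sum_i y i) v = \sum_i dot (y i) v.
Proof.
apply: (big_morph (dot^~ v)) => [u z|]; first exact: dotDl.
exact: dot0l.
Qed.

Lemma dot_ge0 u : 0 <= dot u u.
Proof. by apply: sumr_ge0 => l _; rewrite -expr2 sqr_ge0. Qed.

Lemma enormE u : enorm u = Num.sqrt (dot u u).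
Proof. by congr Num.sqrt; apply: eq_bigr => l _; rewrite expr2. Qed.

Lemma enorm_le u v : (enorm u <= enorm v) = (dot u u <= dot v v).
Proof. by rewrite !enormE ler_psqrt ?nnegrE ?dot_ge0. Qed.

(** Each squared coordinate is one term of the sum under the root. This carries Euclidean bounds
    over to the sup norm of the library; the transfer back to Euclidean limits goes through
    continuity of [dot]. *)
Lemma norm_le_enorm u : `|u| <= enorm u.
Proof.
rewrite [leLHS]/Num.norm/= mx_normrE; apply: bigmax_le => [|[i l] _ /=].
  exact: sqrtr_ge0.
rewrite (ord1 i) -sqrtr_sqr ler_wsqrtr// (bigD1 l)//= lerDl.
by apply: sumr_ge0 => l' _; exact: sqr_ge0.
Qed.

Lemma continuous_dot : continuous (fun u => dot u u).
Proof.
move=> u.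
apply: (@cvg_fin_sum _ R^o _ (nbhs u) _ _ (fun l u => u ord0 l * u ord0 l)) => l.
by apply: cvgM; exact: coord_continuous.
Qed.

Lemma cvg_dot0P {T : Type} (F : set_system T) {FF : Filter F}
    (v : T -> 'rV[R]_n) :
  dot (v x) (v x) @[x --> F] --> (0 : R) <-> v x @[x --> F] --> (0 : 'rV[R]_n).
Proof.
split=> v0.
  apply: norm_cvg0; apply: (@squeeze_cvgr _ _ _ _ (cst 0)
    (fun x => enorm (v x))).
  - by near=> x; rewrite normr_ge0 norm_le_enorm.
  - exact: cvg_cst.
  - under eq_fun do rewrite enormE.
    rewrite -(sqrtr0 R).
    by apply: (cvg_comp _ Num.sqrt v0); exact: sqrt_continuous.
rewrite -(dot0l 0).
exact: (cvg_comp _ (fun u => dot u u) v0 (@continuous_dot 0)).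
Unshelve. all: by end_near. Qed.

Lemma cvg_enorm0P {T : Type} (F : set_system T) {FF : Filter F}
    (v : T -> 'rV[R]_n) :
  enorm (v x) @[x --> F] --> (0 : R) <-> v x @[x --> F] --> (0 : 'rV[R]_n).
Proof.
split=> [v0|/cvg_dot0P v0].
  apply/cvg_dot0P; rewrite -(mul0r (0 : R)).
  have -> : (fun x => dot (v x) (v x)) = (fun x => enorm (v x) * enorm (v x)).
    by apply/funext => x; rewrite -expr2 enormE sqr_sqrtr ?dot_ge0.
  exact: cvgM.
under eq_fun do rewrite enormE.
rewrite -(sqrtr0 R).
by apply: (cvg_comp _ Num.sqrt v0); exact: sqrt_continuous.
Qed.

Lemma continuous_enormB z : continuous (fun q => enorm (z - q)).
Proof.
have -> : (fun q => enorm (z - q)) = fun q => Num.sqrt (dot (z - q) (z - q)).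
  by apply/funext => q; rewrite enormE.
move=> p.
apply: (cvg_comp (fun q => dot (z - q) (z - q)) Num.sqrt);
  last exact: sqrt_continuous.
apply: (cvg_comp (fun q => z - q) (fun u => dot u u)); last exact: continuous_dot.
exact: (@cvgB _ 'rV[R]_n _ (nbhs p) _ (cst z) id z p (cvg_cst z) cvg_id).
Qed.

(** Serves twice: with the constraint set as [C], to find a nearest point, and with the whole space,
    to extract a limit of the iterates. *)
Lemma compact_enorm_ball z r (C : set 'rV[R]_n) :
  closed C -> compact (C `&` [set q | enorm (z - q) <= r]).
Proof.
move=> Ccl; apply: bounded_closed_compact.
  exists (`|z| + r); split; first exact: num_real.
  move=> M zrM q [_ /= qr]; apply: le_trans (ltW zrM).
  rewrite -[q](subKr z) (le_trans (ler_normB _ _))// lerD2l.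
  exact: le_trans (norm_le_enorm _) qr.
apply: closedI => //.
have /continuous_closedP := @continuous_enormB z.
by move=> /(_ [set t | t <= r]); apply; exact: closed_le.
Qed.

(** * Metric projection and barycentres *)

Lemma euclid_projP (C : set 'rV[R]_n) z :
  C !=set0 -> closed C -> is_euclid_proj C z (euclid_proj C z).
Proof.
move=> [q0 Cq0] Ccl.
suff [p pP] : exists p, is_euclid_proj C z p by exact: (xgetI _ pP).
(* Minimizing over this compact slice suffices: points of [C] outside it are farther from [z] than
   [q0] is. *)
pose K := C `&` [set q | enorm (z - q) <= enorm (z - q0)].
have Kc : compact K by exact: compact_enorm_ball.
have K0 : K !=set0 by exists q0; split => //=.
have [p] := EVT_min_rV K0 Kc (continuous_subspaceT (@continuous_enormB z)).
rewrite inE => -[Cp pq0] pmin; exists p; split => // q Cq.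
have [qq0|/ltW qq0] := leP (enorm (z - q)) (enorm (z - q0)).
  by apply: pmin; rewrite inE.
exact: le_trans pq0 qq0.
Qed.

(* The variational inequality dot (z - p) (q - p) <= 0 comes from comparing p
   with p + t (q - p) for small t. *)
Lemma euclid_proj_pythagoras (C : set 'rV[R]_n) z p q :
  convex_set C -> is_euclid_proj C z p -> C q ->
  dot (p - q) (p - q) + dot (p - z) (p - z) <= dot (z - q) (z - q).
Proof.
move=> Ccvx [Cp pmin] Cq.
have obt t : 0 < t -> t <= 1 ->
    2 * dot (z - p) (q - p) <= t * dot (q - p) (q - p).
  move=> t0 t1.
  have : C (t *: q + (1 - t) *: p).
    have := Ccvx q p (Itv01 (ltW t0) t1).
    by rewrite !inE; apply.
  move/pmin; rewrite enorm_le.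
  rewrite (_ : z - (_ + _) = (z - p) - t *: (q - p)); last first.
    by apply/rowP => l; rewrite !mxE; ring.
  rewrite (dotBB _ (t *: _)) !dotZr !dotZl => h; rewrite -(ler_pM2l t0); nra.
have var : dot (z - p) (q - p) <= 0.
  rewrite leNgt; apply/negP; set b := dot _ _ => b0.
  set d := dot (q - p) (q - p).
  have d0 : 0 <= d by exact: dot_ge0.
  have db : 0 < d + b by rewrite ltr_wpDl.
  (* This [t] lies in ]0, 1] even when [d = 0], and [2 * b <= t * d] becomes [2 * (d + b) <= d],
     which is absurd. *)
  have := obt (b / (d + b)); rewrite divr_gt0// => /(_ isT).
  rewrite ler_pdivrMr// mul1r lerDr => /(_ d0).
  rewrite -/b -/d mulrAC ler_pdivlMr//; nra.
have -> : z - q = (z - p) - (q - p) by rewrite opprB addrA subrK.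
rewrite -(opprB z p) -(opprB q p) (dotBB (z - p)) !(dotNl, dotNr) !opprK; lra.
Qed.

(** Parallel-axis identity: the cross term vanishes because the weighted deviations from the
    barycentre [c] sum to zero. *)
Lemma dot_variance (I : finType) (b : I -> R) (y : I -> 'rV[R]_n) c q :
  \sum_i b i = 1 -> c = \sum_i b i *: y i ->
  \sum_i b i * dot (y i - q) (y i - q) =
  dot (c - q) (c - q) + \sum_i b i * dot (y i - c) (y i - c).
Proof.
move=> b1 cE.
have cross : \sum_i b i * dot (y i - c) (q - c) = 0.
  under eq_bigr do rewrite -dotZl.
  rewrite -dot_suml; under eq_bigr do rewrite scalerBr.
  by rewrite sumrB -scaler_suml b1 scale1r -cE subrr dot0l.
have step i : b i * dot (y i - q) (y i - q) =
    b i * dot (y i - c) (y i - c) - 2 * (b i * dot (y i - c) (q - c)) +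
    b i * dot (c - q) (c - q).
  have -> : y i - q = (y i - c) - (q - c) by rewrite opprB addrA subrK.
  by rewrite dotBB -(opprB q c) dotNl dotNr opprK; ring.
under eq_bigr do rewrite step.
rewrite big_split sumrB -mulr_sumr cross -mulr_suml b1 /=; ring.
Qed.

End euclidean_norm.

(** * Lyapunov sequences, bounded gaps and ultrafilters *)

Lemma lyapunov_cvg (R : realType) (s d : R^nat) :
  (forall k, 0 <= s k) -> (forall k, 0 <= d k) ->
  (forall k, s k.+1 + d k <= s k) -> cvgn s /\ d @ \oo --> (0 : R).
Proof.
move=> s0 d0 sd.
have sdecr : nonincreasing_seq s.
  apply/nonincreasing_seqP => k; apply: le_trans (sd k).
  by rewrite lerDl.
have scvg : cvgn s.
  by apply: nonincreasing_is_cvgn => //; exists 0 => _ [k _ <-].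
(* [d] is squeezed between 0 and the successive drops of the convergent sequence [s]. *)
split=> //; apply: (@squeeze_cvgr _ _ _ _ (cst 0) (fun k => s k - s k.+1)).
- by near=> k; rewrite d0/= lerBrDl.
- exact: cvg_cst.
- rewrite -(subrr (limn s)); apply: cvgB => //.
  by have := scvg; rewrite -(cvg_shiftS s).
Unshelve. all: by end_near. Qed.

Lemma cvg0_le_norm {R : realType} {V : normedModType R} {T : Type}
    (F : set_system T) {FF : Filter F} (v : T -> V) (r : T -> R) :
  (forall k, `|v k| <= r k) -> r @ F --> (0 : R) -> v @ F --> (0 : V).
Proof.
move=> vr r0; apply: norm_cvg0.
apply: (@squeeze_cvgr _ _ _ _ (cst 0) r) => //; last exact: cvg_cst.
by near=> k; rewrite normr_ge0 vr.
Unshelve. all: by end_near. Qed.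

(** At a time [l] of the window where [b l] is at least [eta], the norm of [y l] is at most [eta^-1]
    times that of [b l *: y l]; going from [k] to [l] costs fewer than [B] increments, each tending
    to 0. *)
Lemma cvgn0_bounded_gaps {R : realType} {V : normedModType R} (eta : R)
    (B : nat) (b : nat -> R) (y : nat -> V) : 0 < eta ->
  (forall k, exists2 l, (k <= l < k + B)%N & eta <= b l) ->
  (y k.+1 - y k) @[k --> \oo] --> (0 : V) ->
  (b k *: y k) @[k --> \oo] --> (0 : V) ->
  y k @[k --> \oo] --> (0 : V).
Proof.
move=> eta0 gaps dy0 by0.
(* Since [l] varies with [k], the majorant sums over all offsets of the window; it has a fixed
   number of terms, so its limit can be taken termwise. *)
pose r k := \sum_(o < B) (`|y (k + o).+1 - y (k + o)%N| +
                          eta^-1 * `|b (k + o)%N *: y (k + o)%N|).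
have near_step k o : `|y k| <= `|y (k + o)%N| +
    \sum_(t < o) `|y (k + t).+1 - y (k + t)%N|.
  elim: o => [|o IH]; first by rewrite addn0 big_ord0 addr0.
  apply: le_trans IH _; rewrite big_ord_recr/= addnS.
  have := ler_normD (y (k + o).+1) (y (k + o)%N - y (k + o).+1).
  rewrite (addrC (y (k + o).+1)) subrK (distrC (y (k + o)%N)); lra.
apply: (@cvg0_le_norm _ _ _ _ _ _ r).
  move=> k; have [l /andP[kl lkB] bl] := gaps k.
  have lB : (l - k < B)%N by rewrite ltn_subLR.
  have bl0 : 0 < b l by exact: lt_le_trans bl.
  rewrite /r big_split/= addrC.
  apply: (le_trans (near_step k (l - k)%N)); apply: lerD.
    rewrite (bigD1 (Ordinal lB))//= subnKC//.
    rewrite -[leLHS]addr0 lerD//.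
      rewrite normrZ (gtr0_norm bl0) mulrA ler_peMl//.
      by rewrite mulrC ler_pdivlMr// mul1r.
    by apply: sumr_ge0 => o _; rewrite mulr_ge0// invr_ge0 ltW.
  rewrite -!(big_mkord predT (fun o => `|y (k + o).+1 - y (k + o)%N|)).
  by rewrite (big_cat_nat (leq0n _) (ltnW lB))//= lerDl sumr_ge0.
rewrite [X in _ --> X](_ : 0 = \sum_(o < B) (0 + eta^-1 * 0)); last first.
  by rewrite big1// => o _; rewrite mulr0 addr0.
apply: (@cvg_fin_sum _ R^o) => o.
have shift (W : normedModType R) (f : nat -> W) : f k @[k --> \oo] --> (0 : W) ->
    `|f (k + o)%N| @[k --> \oo] --> (0 : R).
  move=> f0; apply/norm_cvg0P.
  exact: (cvg_comp (addn^~ (o : nat)) f (cvg_addnr o) f0).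
apply: cvgD; first exact: (shift _ (fun k => y k.+1 - y k)).
by apply: cvgMl_tmp; exact: (shift _ (fun k => b k *: y k)).
Qed.

Lemma connect_equiv_closed (T : finType) (e : rel T) (P : T -> T -> Prop) :
  (forall u, P u u) -> (forall u v w, P u v -> P v w -> P u w) ->
  (forall u v, e u v -> P u v) -> forall u v, connect e u v -> P u v.
Proof.
move=> Prefl Ptrans Pe u v /connectP[p + ->].
elim: p u => [|w p IH] u //= /andP[uw wp].
by apply: Ptrans (IH _ wp); exact: Pe.
Qed.

(** If a proper filter finer than the image held a set whose preimage is not in [U], it would also
    hold the complement of that set. *)
Lemma ultra_fmap (S T : Type) (f : S -> T) (U : set_system S) :
  UltraFilter U -> UltraFilter (f @ U).
Proof.
move=> UU; constructor; first exact: fmap_proper_filter.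
move=> G GG fUG; apply/seteqP; split => // A GA.
have [//|UnA] := in_ultra_setVsetC (f @^-1` A) UU.
have GnA : G (~` A) by exact: fUG.
have : G (A `&` ~` A) by exact: filterI.
by rewrite setICr => G0; have [] := filter_ex G0.
Qed.

(** * Lyapunov decrease along the projected consensus iteration *)

Section projected_consensus.
Context {R : realType} {m n : nat} (X : 'I_m -> set 'rV[R]_n)
  (X_nonempty : forall i, X i !=set0) (X_closed : forall i, closed (X i))
  (X_convex : forall i, convex_set (X i))
  (a : nat -> 'M[R]_m) (a_stochastic : doubly_stochastic a)
  (x w : 'I_m -> nat -> 'rV[R]_n)
  (w_def : forall i k, w i k = \sum_(j < m) a k i j *: x j k)
  (x_step : forall i k, x i k.+1 = euclid_proj (X i) (w i k)).

Definition spread (q : 'rV[R]_n) k : R :=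
  \sum_i dot (x i k - q) (x i k - q).

(** The guaranteed one-step loss of [spread q]; the same quantity works for every [q] in the
    intersection. *)
Definition decrement k : R :=
  \sum_i (dot (x i k.+1 - w i k) (x i k.+1 - w i k) +
          \sum_j a k i j * dot (x j k - w i k) (x j k - w i k)).

Let disagreement_ge0 i k :
  0 <= \sum_j a k i j * dot (x j k - w i k) (x j k - w i k).
Proof.
case: a_stochastic => a0 _ _.
by apply: sumr_ge0 => j _; rewrite mulr_ge0 ?dot_ge0.
Qed.

Lemma decrement_ge0 k : 0 <= decrement k.
Proof. by apply: sumr_ge0 => i _; rewrite addr_ge0 ?dot_ge0. Qed.

Lemma spread_ge0 q k : 0 <= spread q k.
Proof. by apply: sumr_ge0 => i _; exact: dot_ge0. Qed.

Lemma spread_step q k : (\bigcap_i X i) q ->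
  spread q k.+1 + decrement k <= spread q k.
Proof.
case: a_stochastic => a0 arow acol qX.
(* Column sums equal to 1 distribute the spread over the receivers; row sums equal to 1 then make
   each [w i k] a barycentre. *)
have -> : spread q k =
    \sum_i \sum_j a k i j * dot (x j k - q) (x j k - q).
  rewrite exchange_big; apply: eq_bigr => j _.
  by rewrite -mulr_suml acol mul1r.
rewrite -big_split; apply: ler_sum => i _ /=.
rewrite (dot_variance q (arow k i) (w_def i k)) addrA lerD2r.
apply: (euclid_proj_pythagoras (@X_convex i)); last exact: qX.
by rewrite x_step; exact: euclid_projP.
Qed.

Lemma decrement_cvg0 q : (\bigcap_i X i) q -> decrement @ \oo --> (0 : R).
Proof.
move=> qX; apply: (lyapunov_cvg (spread_ge0 q) decrement_ge0 _).2 => k.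
exact: spread_step.
Qed.

Lemma spread_cvg q : (\bigcap_i X i) q -> cvgn (spread q).
Proof.
move=> qX; apply: (lyapunov_cvg (spread_ge0 q) decrement_ge0 _).1 => k.
exact: spread_step.
Qed.

Let term_le_decrement i k :
  dot (x i k.+1 - w i k) (x i k.+1 - w i k) +
    \sum_j a k i j * dot (x j k - w i k) (x j k - w i k) <= decrement k.
Proof.
rewrite /decrement [leRHS](bigD1 i)//= lerDl.
by apply: sumr_ge0 => j _; rewrite addr_ge0 ?dot_ge0.
Qed.

(** * Asymptotic agreement of the agents *)

Section vanishing.
Context (q : 'rV[R]_n) (qX : (\bigcap_i X i) q)
  (eta : R) (eta_gt0 : 0 < eta) (a_diag : forall i k, eta <= a k i i).

Lemma projection_error_cvg0 i :
  (x i k.+1 - w i k) @[k --> \oo] --> (0 : 'rV[R]_n).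
Proof.
apply/cvg_dot0P; apply: (@squeeze_cvgr _ _ _ _ (cst 0) decrement).
- near=> k; rewrite dot_ge0/=; apply: le_trans (term_le_decrement i k).
  by rewrite lerDl.
- exact: cvg_cst.
- exact: decrement_cvg0 qX.
Unshelve. all: by end_near. Qed.

Lemma weighted_deviation_cvg0 i j :
  (a k i j *: (x j k - w i k)) @[k --> \oo] --> (0 : 'rV[R]_n).
Proof.
case: a_stochastic => a0 arow _.
apply/cvg_dot0P; apply: (@squeeze_cvgr _ _ _ _ (cst 0) decrement).
- near=> k; rewrite dot_ge0/=; apply: le_trans (term_le_decrement i k).
  (* The squared norm carries the weight squared and [decrement] the weight itself; weights are at
     most 1. *)
  rewrite (bigD1 j)//= addrCA dotZl dotZr -[leLHS]addr0 lerD//.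
    rewrite ler_wpM2l// ler_piMl ?dot_ge0//.
    by rewrite -(arow k i) (bigD1 j)//= lerDl sumr_ge0.
  by rewrite addr_ge0 ?dot_ge0// sumr_ge0// => l _; rewrite mulr_ge0 ?dot_ge0.
- exact: cvg_cst.
- exact: decrement_cvg0 qX.
Unshelve. all: by end_near. Qed.

(** The self-weight is bounded below by [eta], so it can be divided out of the weighted deviation
    with [j = i]. *)
Lemma deviation_cvg0 i : (x i k - w i k) @[k --> \oo] --> (0 : 'rV[R]_n).
Proof.
apply: (@cvg0_le_norm _ _ _ _ _ _
  (fun k => eta^-1 * `|a k i i *: (x i k - w i k)|)).
  move=> k; have ai0 := lt_le_trans eta_gt0 (a_diag i k).
  rewrite normrZ (gtr0_norm ai0) mulrA ler_peMl//.
  by rewrite mulrC ler_pdivlMr// mul1r.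
rewrite -(mulr0 eta^-1); apply: cvgMl_tmp; apply/norm_cvg0P.
exact: weighted_deviation_cvg0.
Qed.

Lemma increment_cvg0 i : (x i k.+1 - x i k) @[k --> \oo] --> (0 : 'rV[R]_n).
Proof.
have -> : (fun k => x i k.+1 - x i k) =
    (fun k => (x i k.+1 - w i k) - (x i k - w i k)).
  by apply/funext => k; rewrite opprB addrA subrK.
rewrite -(subrr (0 : 'rV[R]_n)).
exact: cvgB (projection_error_cvg0 i) (deviation_cvg0 i).
Qed.

Lemma weighted_difference_cvg0 i j :
  (a k i j *: (x j k - x i k)) @[k --> \oo] --> (0 : 'rV[R]_n).
Proof.
case: a_stochastic => a0 arow _.
have -> : (fun k => a k i j *: (x j k - x i k)) =
    (fun k => a k i j *: (x j k - w i k) - a k i j *: (x i k - w i k)).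
  by apply/funext => k; rewrite -scalerBr opprB addrA subrK.
rewrite -(subrr (0 : 'rV[R]_n)).
apply: cvgB; first exact: weighted_deviation_cvg0.
apply: (@cvg0_le_norm _ _ _ _ _ _ (fun k => `|x i k - w i k|)).
  move=> k; rewrite normrZ ger0_norm// ler_piMl//.
  by rewrite -(arow k i) (bigD1 j)//= lerDl sumr_ge0.
by apply/norm_cvg0P; exact: deviation_cvg0.
Qed.

Lemma consensus_cvg0 (a_pos : forall i j k, 0 < a k i j -> eta <= a k i j) :
  connectivity a -> bounded_intercomm a ->
  forall i j, (x j k - x i k) @[k --> \oo] --> (0 : 'rV[R]_n).
Proof.
move=> conn [B _ gaps] i j.
apply: (@connect_equiv_closed _ (edge_infty a)
  (fun u v => (x u k - x v k) @[k --> \oo] --> (0 : 'rV[R]_n))); last exact: conn.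
- by move=> u; under eq_fun do rewrite subrr; exact: cvg_cst.
- move=> u v z uv vz.
  have -> : (fun k => x u k - x z k) = (fun k => (x u k - x v k) + (x v k - x z k)).
    by apply/funext => k; rewrite addrA subrK.
  by rewrite -(addr0 (0 : 'rV[R]_n)); exact: cvgD.
- move=> u v uv.
  (* The edge from [u] to [v] carries the weight that the receiver [v] gives to [u], hence the
     swapped indices. *)
  apply: (@cvgn0_bounded_gaps _ _ eta B (fun k => a k v u)) => //.
  + move=> k; have [l kl el] := gaps u v uv k.
    by exists l => //; exact: a_pos.
  + have -> : (fun k => x u k.+1 - x v k.+1 - (x u k - x v k)) =
        (fun k => (x u k.+1 - x u k) - (x v k.+1 - x v k)).
      by apply/funext => k; rewrite !opprD !opprK addrACA.
    rewrite -(subrr (0 : 'rV[R]_n)).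
    exact: cvgB (increment_cvg0 u) (increment_cvg0 v).
  + exact: weighted_difference_cvg0.
Qed.

End vanishing.

End projected_consensus.

(** * Common limit in the intersection of the constraint sets *)

Theorem proposition2 (R : realType) (m n : nat)
  (X : 'I_m -> set 'rV[R]_n)
  (X_nonempty : forall i, X i !=set0)
  (X_closed : forall i, closed (X i))
  (X_convex : forall i, convex_set (X i))
  (capX_nonempty : (\bigcap_i X i) !=set0)
  (a : nat -> 'M[R]_m)
  (a_weights : weights_rule a)
  (a_stochastic : doubly_stochastic a)
  (a_connected : connectivity a)
  (a_intercomm : bounded_intercomm a)
  (x w : 'I_m -> nat -> 'rV[R]_n)
  (w_def : forall i k, w i k = \sum_(j < m) a k i j *: x j k)
  (x_init : forall i, X i (x i 0%N))
  (x_step : forall i k, x i k.+1 = euclid_proj (X i) (w i k)) :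
  exists2 xt : 'rV[R]_n, (\bigcap_i X i) xt &
    forall i : 'I_m,
      (fun k => enorm (x i k - xt)) @ \oo --> (0 : R) /\
      (fun k => enorm (w i k - xt)) @ \oo --> (0 : R).
Proof.
have [c cX] := capX_nonempty.
(* For [m = 0] any point will do; otherwise [i0] is the reference agent whose limit is extracted
   first. *)
have [i0 _|no_agent] := pickP 'I_m; last first.
  by exists c => // i; have := no_agent i.
have [eta [eta0 _ eta_le]] := a_weights.
have a_diag i k : eta <= a k i i by exact: (eta_le i).1.
have a_pos i j k : 0 < a k i j -> eta <= a k i j by exact: (eta_le i).2.
have xX i k : X i (x i k).
  case: k => [|k]; first exact: x_init.
  by rewrite x_step; have [] := euclid_projP (w i k) (X_nonempty i) (X_closed i).
pose S := spread x.
have S_step q k : (\bigcap_i X i) q -> S q k.+1 <= S q k.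
  move=> qX.
  have := spread_step X_nonempty X_closed X_convex a_stochastic w_def x_step
    k qX.
  by apply: le_trans; rewrite lerDl; exact: decrement_ge0.
have term_le_S q i k : dot (x i k - q) (x i k - q) <= S q k.
  by rewrite /S /spread (bigD1 i)//= lerDl sumr_ge0// => j _; exact: dot_ge0.
have bounded k : enorm (c - x i0 k) <= Num.sqrt (S c 0%N).
  rewrite enormE ler_wsqrtr// -opprB dotNl dotNr opprK.
  apply: le_trans (term_le_S _ _ _) _.
  elim: k => // k; exact: le_trans (S_step _ _ cX).
(* The ultrafilter plays the role of a convergent subsequence; limits at infinity persist along it
   by [lift]. *)
have [U [UU ooU]] := ultraFilterLemma (eventually_filter : ProperFilter \oo).
have lift (V : topologicalType) (f : nat -> V) (l : V) : f @ \oo --> l -> f @ U --> l.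
  by move=> fl A /fl; exact: ooU.
have [xt x0xt] : exists xt : 'rV[R]_n, x i0 @ U --> xt.
  have := @compact_enorm_ball R n c (Num.sqrt (S c 0%N)) setT closedT.
  rewrite compact_ultra => /(_ _ (ultra_fmap (x i0) UU))[|xt [_ xtl]].
    by apply: (@filterE _ U) => k; split => //=.
  by exists xt.
have xxt i : x i @ U --> xt.
  apply/subr_cvg0.
  have -> : (fun k => x i k - xt) = (fun k => (x i k - x i0 k) + (x i0 k - xt)).
    by apply/funext => k; rewrite addrA subrK.
  rewrite -(addr0 (0 : 'rV[R]_n)); apply: cvgD; last exact/subr_cvg0.
  apply: lift.
  exact: (consensus_cvg0 X_nonempty X_closed X_convex a_stochastic w_def x_step
    cX eta0 a_diag a_pos a_connected a_intercomm).
have xtX : (\bigcap_i X i) xt.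
  move=> i _; apply: (closed_cvg (X i) (X_closed i) _ xt (xxt i)).
  by near=> k; exact: xX.
have S0 : S xt @ \oo --> (0 : R).
  have SL := spread_cvg X_nonempty X_closed X_convex a_stochastic w_def x_step xtX.
  have SU : S xt @ U --> (0 : R).
    rewrite [X in _ --> X](_ : 0 = \sum_(i < m) 0); last by rewrite big1.
    apply: (@cvg_fin_sum _ R^o) => i.
    by apply/cvg_dot0P/subr_cvg0.
  (* The spread about [xt] already converges at infinity, so its limit along [U] identifies the full
     limit as 0. *)
  by rewrite -(cvg_unique _ (lift _ _ _ SL) SU).
have x_lim i : (x i k - xt) @[k --> \oo] --> (0 : 'rV[R]_n).
  apply/cvg_dot0P; apply: (@squeeze_cvgr _ _ _ _ (cst 0) (S xt)) => //.
    by near=> k; rewrite dot_ge0 term_le_S.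
  exact: cvg_cst.
exists xt => // i; split; apply/cvg_enorm0P; first exact: x_lim.
have -> : (fun k => w i k - xt) = (fun k => (x i k - xt) - (x i k - w i k)).
  by apply/funext => k; rewrite opprB [RHS]addrC addrA subrK.
rewrite -(subrr (0 : 'rV[R]_n)); apply: cvgB; first exact: x_lim.
exact: (deviation_cvg0 X_nonempty X_closed X_convex a_stochastic w_def x_step
  cX eta0 a_diag).
Unshelve. all: by end_near. Qed.
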